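(* Let $G$ and $H$ be two finitely generated groups such that $H$ is a finite index subgroup of $G$. If $G$ is periodically rigid, then $H$ is periodically rigid.
   Context: Let $G$ be a finitely generated group and $A$ a finite set (alphabet). $G$ acts on $A^G$ by $(g\cdot x)_h := x_{g^{-1}h}$. A pattern is an element $p\in A^{P}$ with $P\subseteq G$ finite; $p$ appears in $x\in A^G$ if there is $g\in G$ with $(g\cdot x)_h=p_h$ for all $h\in P$. For a set $\mathcal{F}$ of patterns, $X_{\mathcal{F}}\subseteq A^G$ is the set of all $x\in A^G$ in which no pattern of $\mathcal{F}$ appears. A subshift of finite type (SFT) on $G$ is a set of the form $X_{\mathcal{F}}$ with $\mathcal{F}$ finite (for some finite alphabet $A$). A configuration $x$ is strongly periodic if its orbit $\{g\cdot x\mid g\in G\}$ is finite, and weakly periodic if its stabilizer $\{g\in G\mid g\cdot x=x\}$ is nontrivial. A subshift is weakly aperiodic if it is nonempty and contains no strongly periodic configuration; it is strongly aperiodic if it is nonempty and contains no weakly periodic configuration. $G$ is periodically rigid if there is no SFT on $G$ (over any finite alphabet) that is weakly aperiodic but not strongly aperiodic. *)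

(* Defs.v *)
From HB Require Import structures.
From mathcomp Require Import all_boot finmap.
From mathcomp Require Import boolp classical_sets cardinality.

Set Implicit Arguments.
Unset Strict Implicit.
Unset Printing Implicit Defensive.

Local Open Scope classical_set_scope.
Local Open Scope group_scope.

(* A group (not assumed finite) is a [groupType].  A subgroup of [G] with
   carrier [S : pred G] is a [subGroupType S], whose inclusion into [G] is
   [val]. *)

Definition finitely_generated (G : groupType) : Prop :=
  exists s : seq G, forall K : {pred G},
    group_closed K -> {subset s <= K} -> forall g : G, g \in K.

Definition finite_index (G : groupType) (S : pred G) : Prop :=
  finite_set [set [set g * h | h in [set` S]] | g in [set: G]].

Section Shift.
Variables (G : groupType) (A : finType).
Implicit Types (x : G -> A) (X : set (G -> A)).

Definition shift (g : G) x : G -> A := fun h => x (g^-1 * h).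

(* A finite map [p : {fmap G -> A}] is an element of [A^P] for the finite
   subset [P = domf p] of [G]; the empty pattern is allowed. *)
Definition pattern := {fmap G -> A}.

Definition appears (p : pattern) x : Prop :=
  exists g : G, forall h : domf p, shift g x (val h) = p h.

Definition subshift (F : set pattern) : set (G -> A) :=
  [set x | forall p, F p -> ~ appears p x].

Definition is_SFT X : Prop :=
  exists2 F : set pattern, finite_set F & X = subshift F.

Definition orbit x : set (G -> A) := [set shift g x | g in [set: G]].

Definition stabilizer x : set G := [set g | shift g x = x].

Definition strongly_periodic x : Prop := finite_set (orbit x).

Definition weakly_periodic x : Prop := stabilizer x <> [set 1].

Definition weakly_aperiodic X : Prop :=
  X !=set0 /\ ~ exists2 x, X x & strongly_periodic x.

Definition strongly_aperiodic X : Prop :=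
  X !=set0 /\ ~ exists2 x, X x & weakly_periodic x.

End Shift.

Definition periodically_rigid (G : groupType) : Prop :=
  ~ exists (A : finType) (X : set (G -> A)),
      [/\ is_SFT X, weakly_aperiodic X & ~ strongly_aperiodic X].

(* Main.v *)
Require Import Defs.
From mathcomp Require Import all_boot finmap.
From mathcomp Require Import boolp classical_sets cardinality.

(** Contrapositive: from an SFT [X] on [H] that is weakly but not strongly
    aperiodic, over the alphabet [A], one builds such an SFT [Y] on [G], over
    [option A]; a cell holding [None] is blank.  A configuration is in [Y]
    when each left coset of [H] is either blank or a copy of some element of
    [X], and not every coset is blank.

    Why blanks: putting an element of [X] on every coset would also give a
    weakly aperiodic SFT, but its elements might have no nontrivial period.
    Left multiplication by a period [h] of [x] permutes the cosets; a power of
    [h] that stabilizes [g H] acts on it, in the coordinate [k |-> g k], as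
    multiplication by its conjugate under [g], which need not be a period of
    any element of [X].  With blanks available, [x] is written on [H] alone,
    and [h] stabilizes the result because [h H = H]
    ([weakly_periodic_extend]).

    [Y] is of finite type ([coset_shift_SFT]) because [H] is finitely generated
    and of finite index: right multiplication by generators of [H] stays in a
    left coset, so being blank is constant on cosets as soon as it is preserved
    by these generators; and if [T] meets every left coset, so does each
    translate of [T], so requiring a nonblank cell in every translate of [T]
    excludes the blank configuration.  The latter is strongly periodic, so it
    must be excluded.

    Finally a strongly periodic element of [Y] would restrict, on one of its
    nonblank cosets, to a strongly periodic element of [X]
    ([coset_shift_strongly_periodic]). *)

Set Implicit Arguments.
Unset Strict Implicit.
Unset Printing Implicit Defensive.

Local Open Scope classical_set_scope.
Local Open Scope group_scope.

(** Any condition read through a finite window, imposed at every position,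
    defines an SFT: forbid the patterns on the window [D] that come from
    configurations violating [Q].  There are finitely many of them since the
    alphabet is finite. *)
Lemma is_SFT_window (G : groupType) (A : finType) (D : seq G)
    (Q : set (G -> A)) :
  (forall x y : G -> A, {in D, x =1 y} -> Q x -> Q y) ->
  is_SFT [set y : G -> A | forall g, Q (shift g y)].
Proof.
move=> Qloc; pose E : {fset G} := [fset g in D]%fset.
pose restr (x : G -> A) : pattern G A := [fmap h : E => x (val h)]%fmap.
exists [set restr x | x in ~` Q].
  pose of_ffun (f : {ffun E -> A}) : pattern G A := [fmap h : E => f h]%fmap.
  have fin_of_ffun : finite_set (range of_ffun).
    exact/finite_image/finite_finset.
  apply: sub_finite_set fin_of_ffun.
  move=> _ [x _ <-]; exists [ffun h : E => x (val h)] => //.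
  apply/fmapP => g; case: (fndP (restr x) g) => gE.
    by rewrite /of_ffun /restr; rewrite !in_fnd !ffunE.
  by rewrite not_fnd.
apply/seteqP; split=> y /=.
  move=> Qy _ [x nQx <-] [g yx]; apply/nQx/(Qloc (shift g y)) => // h hD.
  have hE : h \in domf (restr x) by rewrite /= in_fset.
  by have := yx [` hE]%fset; rewrite ffunE.
move=> avoid g; apply: contrapT => nQ.
apply: (avoid (restr (shift g y))); first by exists (shift g y).
by exists g => h; rewrite ffunE.
Qed.

Lemma finite_index_representatives (G : groupType) (S : pred G)
    (H : subGroupType S) :
  finite_index S -> exists T : seq G,
    forall g, exists2 t, t \in T & exists h : H, g = t * val h.
Proof.
move=> /finite_seqP [cosets cosetsE].
have repr_ex (C : set G) : exists t : G, C \in cosets ->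
    C = [set t * h | h in [set` S]].
  case: (boolP (C \in cosets)) => [|_]; last by exists 1.
  move=> CT; have: [set` cosets] C by [].
  by rewrite -cosetsE => -[g _ <-]; exists g.
have [repr reprE] := choice repr_ex.
exists (map repr cosets) => g; pose C := [set g * h | h in [set` S]].
have CT : C \in cosets.
  have : [set` cosets] C by rewrite -cosetsE; exists g.
  by [].
exists (repr C); first exact: map_f.
have: C g by exists 1; rewrite ?mulg1 //=; have := valP (1 : H); rewrite val1.
by rewrite {1}(reprE C CT) => -[s Ss <-]; exists (Sub s Ss); rewrite SubK.
Qed.

Section Extension.
Variables (G : groupType) (S : pred G) (H : subGroupType S) (A : finType).

Definition extend (x : H -> A) : G -> option A :=
  fun g => omap x (insub g).

Lemma extend_val (x : H -> A) h : extend x (val h) = Some (x h).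
Proof. by rewrite /extend valK. Qed.

Lemma isSome_extend (x : H -> A) g : isSome (extend x g) = S g.
Proof. by rewrite /extend; case: insubP => [? -> //|/negbTE]. Qed.

Lemma mem_mul_val (g : G) (h : H) : S (g * val h) = S g.
Proof.
apply/idP/idP => Sg.
  have -> : g = val (Sub _ Sg * h^-1 : H) by rewrite valM SubK gmulfV mulgK.
  exact: valP.
have -> : g * val h = val (Sub g Sg * h : H) by rewrite valM SubK.
exact: valP.
Qed.

Lemma mem_val_mul (h : H) (g : G) : S (val h * g) = S g.
Proof.
apply/idP/idP => Sg.
  have -> : g = val (h^-1 * Sub _ Sg : H) by rewrite valM SubK gmulfV mulKg.
  exact: valP.
have -> : val h * g = val (h * Sub g Sg : H) by rewrite valM SubK.
exact: valP.
Qed.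

Lemma shift_extend (x : H -> A) h :
  shift (val h) (extend x) = extend (shift h x).
Proof.
apply/funext => g; rewrite /shift; have [Sg|nSg] := boolP (S g).
  have -> : g = val (Sub g Sg : H) by rewrite SubK.
  by rewrite -gmulfV -valM !extend_val.
have : isSome (extend x ((val h)^-1 * g)) = false.
  by rewrite isSome_extend -gmulfV mem_val_mul (negbTE nSg).
have : isSome (extend (shift h x) g) = false.
  by rewrite isSome_extend (negbTE nSg).
by rewrite /shift; do 2 case: (extend _ _).
Qed.

(** The blanks are invariant under left multiplication by [H], so [x] and
    [extend x] have the same periods in [H]. *)
Lemma weakly_periodic_extend (x : H -> A) :
  weakly_periodic x -> weakly_periodic (extend x).
Proof.
move=> wx stabE; apply: wx; apply/seteqP; split=> [h hx|_ ->] /=.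
  have: stabilizer (extend x) (val h) by rewrite /stabilizer /= shift_extend hx.
  by rewrite stabE => h1; apply: val_inj; rewrite val1.
by apply/funext => k; rewrite /shift invg1 mul1g.
Qed.

Section CosetSFT.
Variables (gens : seq H) (T : seq G) (F : set (pattern H A)).

(** The local rule, around the identity, of the SFT on [G]; [gens] stands for
    generators of [H], [T] for representatives of its left cosets, and [F]
    for the forbidden patterns of the given SFT on [H]. *)
Definition coset_rule : set (G -> option A) := [set y |
  [/\ {in gens, forall s, isSome (y (val s)) = isSome (y 1)},
      exists2 t, t \in T & isSome (y t)
    & forall p, F p -> ~ forall h : domf p, y (val (val h)) = Some (p h)]].

Definition coset_shift : set (G -> option A) :=
  [set y | forall g, coset_rule (shift g y)].

Lemma coset_shift_SFT : finite_set F -> is_SFT coset_shift.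
Proof.
move=> /finite_seqP [ps FE].
pose supports : seq G := flatten [seq map val (domf p : seq H) | p <- ps].
apply: (@is_SFT_window _ _ (1 :: map val gens ++ T ++ supports)).
move=> x y xy [x_gens [t tT xt] x_F]; split.
- move=> s sg; rewrite -!xy ?x_gens ?inE ?eqxx //.
  by rewrite !mem_cat map_f ?orbT.
- by exists t => //; rewrite -xy // inE !mem_cat tT !orbT.
- move=> p Fp yp; apply: (x_F p Fp) => h; rewrite xy ?yp //.
  rewrite inE !mem_cat; apply/orP; right; apply/orP; right; apply/orP; right.
  apply/flattenP; exists (map val (domf p : seq H)); last exact/map_f/valP.
  apply: (map_f (fun p : pattern H A => map val (domf p : seq H))).
  by move: Fp; rewrite FE.
Qed.

Hypothesis gens_gen : forall K : {pred H},
  group_closed K -> {subset gens <= K} -> forall h : H, h \in K.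

(** The elements of [H] whose right translation preserves blankness form a
    subgroup, which contains the generators.  Divisions cause no trouble,
    because the rule on a generator is an equality and not an implication. *)
Lemma isSome_coset y : coset_shift y ->
  forall g (h : H), isSome (y (g * val h)) = isSome (y g).
Proof.
move=> Yy g h; move: g.
pose K : {pred H} :=
  [pred h | `[< forall g, isSome (y (g * val h)) = isSome (y g) >]].
suff /asboolP: h \in K by [].
apply: gens_gen => [|s sg].
  split=> [|a b].
    by apply/asboolP => g; rewrite val1 mulg1.
  move=> /asboolP Ka /asboolP Kb; apply/asboolP => g.
  by rewrite valM gmulfV mulgA -Kb mulgVK Ka.
apply/asboolP => g.
by have [/(_ s sg) + _ _] := Yy g^-1; rewrite /shift invgK mulg1.
Qed.

(** Seen from [g], the copy of [x] lies on the left coset [g * H], which [T]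
    meets.  For a forbidden pattern there are two cases: either its support is
    translated into [H], so that it would appear in [x], or into a blank
    coset. *)
Lemma extend_coset_shift (x : H -> A) :
  (forall g, exists2 t, t \in T & exists h : H, g = t * val h) ->
  subshift F x -> coset_shift (extend x).
Proof.
move=> T_repr Xx g; split.
- by move=> s _; rewrite /shift !isSome_extend mulg1 mem_mul_val.
- have [t tT [h gE]] := T_repr g; exists t => //.
  rewrite /shift isSome_extend gE invgM mulgVK -gmulfV; exact: valP.
- move=> p Fp yp; apply: (Xx p Fp).
  have [Sg|nSg] := boolP (S g^-1).
    exists (Sub _ Sg : H)^-1 => h; apply: Some_inj.
    by rewrite -yp /shift invgK -extend_val valM SubK.
  (* Outside [H] every cell is blank, so only the empty pattern can match; it
     appears anywhere in [x]. *)
  exists 1 => h; have : isSome (shift g (extend x) (val (val h))) by rewrite yp.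
  by rewrite /shift isSome_extend mem_mul_val (negbTE nSg).
Qed.

(** Reading a nonblank coset [t * H] through the coordinate [h |-> t * h] gives
    an element [x] of the original SFT, and each translate of [x] by [H] is
    read off a translate of [y] at [H]; so the orbit of [x] is the image of
    part of the orbit of [y]. *)
Lemma coset_shift_strongly_periodic y :
  coset_shift y -> strongly_periodic y ->
  exists2 x, subshift F x & strongly_periodic x.
Proof.
move=> Yy fin_y; have [_ [t tT ya] _] := Yy 1.
move: ya; rewrite /shift invg1 mul1g.
case ya: (y t) => [a|] // _.
(* The default value [a] is never read on a nonblank coset. *)
pose read (w : G -> option A) : H -> A := fun k => odflt a (w (val k)).
pose x := read (shift t^-1 y).
have xE h : y (t * val h) = Some (x h).
  have := isSome_coset Yy t h; rewrite ya /x /read /shift invgK.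
  by case: (y _).
exists x.
  move=> p Fp [h xp]; have [_ _ /(_ p Fp)] := Yy (val h * t^-1); apply=> k.
  by rewrite /shift invgM invgK -mulgA -gmulfV -valM xE -xp.
apply: sub_finite_set (finite_image read fin_y).
move=> _ [h _ <-]; exists (shift (val h * t^-1) y).
  by exists (val h * t^-1).
apply/funext => k.
by rewrite /read /x /read /shift invgM !invgK valM gmulfV mulgA.
Qed.

End CosetSFT.
End Extension.

Theorem proposition3 (G : groupType) (S : pred G) (H : subGroupType S)
    (G_fg : finitely_generated G) (H_fg : finitely_generated H)
    (H_index : finite_index S) :
  periodically_rigid G -> periodically_rigid H.
Proof.
move=> rigidG [A [X [[F finF XE] [X0 X_sp] X_nsa]]]; subst X.
have [gens gensP] := H_fg.
have [T T_repr] := finite_index_representatives H H_index.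
have [x Xx wx] : exists2 x, subshift F x & weakly_periodic x.
  by apply: contrapT => no_wp; apply: X_nsa.
have Yx := extend_coset_shift gens T_repr Xx.
apply: rigidG; exists (option A), (coset_shift gens T F); split.
- exact: coset_shift_SFT.
- split; first by exists (extend x).
  by move=> [y Yy /(coset_shift_strongly_periodic gensP Yy)].
- by move=> [_]; apply; exists (extend x) => //; apply: weakly_periodic_extend.
Qed.
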